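(* Let $X$ be a paracompact Hausdorff topological manifold of real dimension $n$, and let $\mathcal{F}$ be a sheaf of abelian groups on $X$. Then $$H^p(X,\mathcal{F})=0\quad\text{for every integer } p>n.$$ In other words, the topological dimension of a paracompact topological manifold is less than or equal to its real dimension in the usual sense.
   Context: $H^p(X,\mathcal{F})$ denotes sheaf cohomology. A nonempty topological space $X$ is said to have topological dimension $\leqslant n$ if $H^p(X,\mathcal{F})=0$ for every $p>n$ and every sheaf of abelian groups $\mathcal{F}$ on $X$; the topological dimension of $X$ is the least value of $n$ for which this holds. A topological manifold of real dimension $n$ is a space in which every point has an open neighborhood homeomorphic to an open subset of $\mathbb{R}^n$. *)

(* Defs.v *)
From HB Require Import structures.
From mathcomp Require Import all_boot all_order all_algebra.
From mathcomp Require Import boolp classical_sets functions cardinality.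
From mathcomp Require Import reals topology normedtype.

Set Implicit Arguments.
Unset Strict Implicit.
Unset Printing Implicit Defensive.

Import Order.TTheory GRing.Theory Num.Theory numFieldNormedType.Exports.

Local Open Scope classical_set_scope.
Local Open Scope ring_scope.
Local Open Scope quotient_scope.

Record openset (X : topologicalType) := Openset {
  carrier :> set X;
  carrier_open : open carrier }.

Definition opensetT (X : topologicalType) : openset X := Openset openT.

Definition opensetI (X : topologicalType) (U V : openset X) : openset X :=
  Openset (openI (carrier_open U) (carrier_open V)).

Record presheaf (X : topologicalType) := Presheaf {
  sections :> openset X -> zmodType;
  restr : forall U V : openset X, V `<=` U -> {additive sections U -> sections V};
  restr_id : forall (U : openset X) (UU : U `<=` U) (s : sections U),
    restr UU s = s;
  restr_comp : forall (U V W : openset X) (VU : V `<=` U) (WV : W `<=` V)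
    (WU : W `<=` U) (s : sections U), restr WV (restr VU s) = restr WU s }.
Arguments restr {X p U V} VU.

Definition is_sheaf (X : topologicalType) (F : presheaf X) : Prop :=
  forall (I : Type) (U : I -> openset X) (W : openset X)
    (UW : forall i, U i `<=` W), W `<=` \bigcup_i U i ->
  forall s : (forall i, F (U i)),
    (forall i j,
       restr (V := opensetI (U i) (U j)) (@subIsetl _ (U i) (U j)) (s i) =
       restr (V := opensetI (U i) (U j)) (@subIsetr _ (U i) (U j)) (s j)) ->
  exists! t : F W, forall i, restr (UW i) t = s i.

Record sheaf (X : topologicalType) := Sheaf {
  sheaf_presheaf :> presheaf X;
  sheafP : is_sheaf sheaf_presheaf }.

Record sheaf_hom (X : topologicalType) (F G : sheaf X) := SheafHom {
  hom_app :> forall U : openset X, {additive F U -> G U};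
  hom_nat : forall (U V : openset X) (VU : V `<=` U) (s : F U),
    hom_app V (restr VU s) = restr VU (hom_app U s) }.

Definition sheaf_mono (X : topologicalType) (F G : sheaf X)
    (f : sheaf_hom F G) : Prop :=
  forall U : openset X, injective (f U).

(* The kernel sheaf of g is the image sheaf of f: a section is killed by g
   if and only if it lies locally in the image of f. *)
Definition sheaf_exact (X : topologicalType) (F G H : sheaf X)
    (f : sheaf_hom F G) (g : sheaf_hom G H) : Prop :=
  forall (U : openset X) (t : G U),
    g U t = 0 <->
    forall x : X, carrier U x ->
      exists (V : openset X) (VU : V `<=` U),
        carrier V x /\ exists s : F V, f V s = restr VU t.

Definition injective_sheaf (X : topologicalType) (J : sheaf X) : Prop :=
  forall (A B : sheaf X) (i : sheaf_hom A B) (f : sheaf_hom A J),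
    sheaf_mono i ->
    exists g : sheaf_hom B J, forall (U : openset X) (s : A U), g U (i U s) = f U s.

Record injective_resolution (X : topologicalType) (F : sheaf X) :=
  InjectiveResolution {
    res_obj : nat -> sheaf X;
    res_aug : sheaf_hom F (res_obj 0);
    res_diff : forall p, sheaf_hom (res_obj p) (res_obj p.+1);
    res_injective : forall p, injective_sheaf (res_obj p);
    res_aug_mono : sheaf_mono res_aug;
    res_exact0 : sheaf_exact res_aug (res_diff 0);
    res_exactS : forall p, sheaf_exact (res_diff p) (res_diff p.+1) }.

Lemma int_subgroup (S : int -> Prop) :
  S 0 -> (forall x y, S x -> S y -> S (x - y)) ->
  exists m : nat, forall k, S k <-> (m%:Z %| k)%Z.
Proof.
move=> S0 SB.
have SN x : S x -> S (- x) by move=> Sx; rewrite -sub0r; exact: SB.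
have SD x y : S x -> S y -> S (x + y).
  by move=> Sx Sy; rewrite -[y]opprK; apply: SB => //; exact: SN.
have SMn x n : S x -> S (x * n%:Z).
  move=> Sx; elim: n => [|n IH]; first by rewrite mulr0.
  by rewrite intS mulrDr mulr1; exact: SD.
have SM x k : S x -> S (x * k).
  move=> Sx; case: k => n; first exact: SMn.
  by rewrite NegzE mulrN; apply: SN; exact: SMn.
have [[n n0 Sn]|noS] := pselect (exists2 n : nat, (0 < n)%N & S n%:Z); last first.
  exists 0%N => k; rewrite dvd0z; split=> [Sk|/eqP -> //].
  apply: contrapT => k0; apply: noS; exists `|k|%N.
    by rewrite absz_gt0; apply/negP.
  by rewrite abszE; case: (ger0P k) => // _; exact: SN.
pose P n := (0 < n)%N && `[< S n%:Z >].
have exP : exists n, P n by exists n; apply/andP; split=> //; apply/asboolP.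
case: (ex_minnP exP) => m /andP[m0 /asboolP Sm] minm.
exists m => k; split=> [Sk|/dvdzP[q ->]]; last by rewrite mulrC; exact: SM.
have m0' : m%:Z != 0 by rewrite eqz_nat -lt0n.
have Sr : S (k %% m%:Z)%Z.
  by rewrite /modz mulrC; apply: SB => //; exact: SM.
have r0 := modz_ge0 k m0'.
have rm : ((k %% m%:Z)%Z < m%:Z) by rewrite ltz_pmod // ltz_nat.
apply/dvdz_mod0P; apply: contrapT => rn0.
case E : (k %% m%:Z)%Z r0 rm Sr rn0 => [r|r] // _ rm Sr rn0.
have r_gt0 : (0 < r)%N by rewrite lt0n; apply/eqP => r0; apply: rn0; rewrite r0.
have := minm r; rewrite /P r_gt0 /= => /(_ (introT (asboolP _) Sr)).
by rewrite leqNgt -ltz_nat rm.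
Qed.

Section ExtendHom.
Variables (B D : zmodType).
Hypothesis divD : forall (m : nat) (d : D), (0 < m)%N -> exists e, e *+ m = d.

Let partial_hom (G : set (B * D)) : Prop :=
  [/\ G 0, forall p q, G p -> G q -> G (p - q) & forall d, G (0, d) -> d = 0].

Lemma extend_hom (G0 : set (B * D)) : partial_hom G0 ->
  exists f : {additive B -> D}, forall b d, G0 (b, d) -> f b = d.
Proof.
move=> G0hom.
have [|G [Ghom Gmax]] := @Zorn_bigcup _ [set G | partial_hom (G `|` G0)].
  move=> F Fhom Ftot; have [F0|/set0P[A0 FA0]] := eqVneq F set0; last first.
    split.
    - by right; case: G0hom.
    - have main p q A A' : F A -> F A' -> (A `|` G0) p -> (A' `|` G0) q ->
        (\bigcup_(X in F) X `|` G0) (p - q).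
        move=> FA FA'.
        wlog AA' : A A' FA FA' / A `<=` A' => [wl|].
          have [AA'|AA'] := Ftot _ _ FA FA'; first exact: (wl A A').
          move=> Ap A'q; apply: (wl A A) => //.
          by case: A'q => [/AA'|]; [left|right].
        move=> Ap A'q; have [_ cl _] := Fhom _ FA'.
        have : (A' `|` G0) (p - q).
          by apply: cl => //; case: Ap => [/AA'|]; [left|right].
        by case=> [?|?]; [left; exists A'|right].
      move=> p q [[A FA Ap]|Gp] [[A' FA' A'q]|Gq].
      + by apply: (main _ _ A A') => //; left.
      + by apply: (main _ _ A A) => //; [left|right].
      + by apply: (main _ _ A' A') => //; [right|left].
      + by apply: (main _ _ A0 A0) => //; right.
    - move=> d [[A FA Ad]|G0d]; last by case: G0hom => _ _; apply.
      by have [_ _] := Fhom _ FA; apply; left.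
  by rewrite F0 bigcup_set0 /= set0U.
pose M := G `|` G0.
have {}Mmax M' : partial_hom M' -> M `<=` M' -> M' `<=` M.
  move=> M'hom MM'; apply: contrapT => M'M; apply: (Gmax M').
    split; first by move=> x Gx; apply: MM'; left.
    by move=> M'G; apply: M'M => x /M'G; left.
  rewrite /= (_ : M' `|` G0 = M') //; apply/setUidPl => x G0x.
  by apply: MM'; right.
have [M0 MB Mfun] : partial_hom M := Ghom.
have MN p : M p -> M (- p) by move=> Mp; rewrite -sub0r; exact: MB.
have MD p q : M p -> M q -> M (p + q).
  by move=> Mp Mq; rewrite -[q]opprK; apply: MB => //; exact: MN.
have MMn p n : M p -> M (p *+ n).
  by move=> Mp; elim: n => [|n IH]; rewrite ?mulr0n // mulrS; exact: MD.
have MM p k : M p -> M (p *~ k).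
  by move=> Mp; case: k => n; [exact: MMn|apply: MN; exact: MMn].
have Mtot b : exists d, M (b, d).
  have [||m mP] := @int_subgroup (fun k => exists d, M (b *~ k, d)).
  - by exists 0; rewrite mulr0z.
  - by move=> k l [d Md] [e Me]; exists (d - e); rewrite mulrzBr; exact: (MB _ _ Md Me).
  have [d dP] : exists d, forall k e, M (b *~ k, e) -> d *~ k = e.
    have [m0|m0] := posnP m.
      exists 0 => k e Mke; have /dvdzP[q kq] : (m%:Z %| k)%Z.
        by apply/mP; exists e.
      move: Mke; rewrite kq m0 mulr0 mulr0z mul0rz => /Mfun ->//.
    have [c Mc] : exists c, M (b *~ m%:Z, c) by apply/mP; exact: dvdzz.
    have [d dm] := divD c m0.
    exists d => k e Mke; have /dvdzP[q kq] : (m%:Z %| k)%Z.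
      by apply/mP; exists e.
    have := MB _ _ (MM _ q Mc) Mke.
    rewrite (_ : _ - _ = (0, d *~ k - e)); first by move/Mfun/eqP; rewrite subr_eq0 => /eqP.
    have pairMz (p : B * D) (z : int) : p *~ z = (p.1 *~ z, p.2 *~ z).
      by rewrite [LHS]surjective_pairing !raddfMz.
    rewrite pairMz /= kq; congr pair => /=.
      by rewrite [q * _]mulrC mulrzA subrr.
    by rewrite [q * _]mulrC [in RHS]mulrzA -pmulrn dm.
  exists d.
  pose M' : set (B * D) :=
    [set p | exists k : int, exists2 q, M q & p = (q.1 + b *~ k, q.2 + d *~ k)].
  apply: (Mmax M').
  - split.
    + by exists 0, 0 => //; rewrite !mulr0z !addr0.
    + move=> _ _ [k [q Mq ->]] [l [r Mr ->]]; exists (k - l), (q - r).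
        exact: MB.
      by rewrite !mulrzBr; congr pair; rewrite /= opprD addrACA.
    + move=> e [k [[q1 q2] Mq /= [/esym/eqP]]]; rewrite addrC addr_eq0 => /eqP bk ->.
      have := MN _ Mq; rewrite (_ : - _ = (b *~ k, - q2)); last by rewrite bk.
      by move=> /dP ->; rewrite subrr.
  - by move=> q Mq; exists 0, q => //; rewrite !mulr0z !addr0; case: q {Mq}.
  by exists 1, 0 => //; rewrite !mulr1z !add0r.
have [f fP] := choice Mtot.
have f_add : zmod_morphism f.
  move=> x y; have := MB _ _ (MB _ _ (fP x) (fP y)) (fP (x - y)).
  rewrite (_ : _ - _ = (0, f x - f y - f (x - y))).
    by move/Mfun/eqP; rewrite subr_eq0 => /eqP.
  by congr pair; rewrite /= subrr.
pose fA := GRing.isZmodMorphism.Build B D f f_add.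
exists (HB.pack f fA : {additive B -> D}) => b d G0b /=.
have := MB _ _ (fP b) (or_intror G0b : M (b, d)).
rewrite (_ : _ - _ = (0, f b - d)); last by congr pair; rewrite /= subrr.
by move/Mfun/eqP; rewrite subr_eq0 => /eqP.
Qed.

End ExtendHom.

Definition int_rat : {pred rat} := [pred x | x \is a Num.int].

Fact int_rat_zmod_closed : zmod_closed int_rat.
Proof.
split=> [|x y]; rewrite !inE; first exact: rpred0.
exact: rpredB.
Qed.

HB.instance Definition _ := GRing.isZmodClosed.Build rat int_rat int_rat_zmod_closed.

Definition QZ : zmodType := Quotient.quot int_rat.

Lemma QZ_eq0 (x : rat) : (\pi_QZ x = 0 :> QZ) <-> x \is a Num.int.
Proof.
have -> : (0 : QZ) = \pi_QZ 0 by rewrite raddf0.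
split=> [/eqP|xi]; last first; last first.
  by rewrite -Quotient.idealrBE subr0.
by apply/eqP; rewrite -Quotient.idealrBE subr0.
Qed.

Lemma QZ_divisible (m : nat) (d : QZ) : (0 < m)%N -> exists e, e *+ m = d.
Proof.
move=> m0; exists (\pi_QZ (repr d / m%:R)).
rewrite -raddfMn /= -mulrnAl -mulr_natr mulfK ?reprK //.
by rewrite pnatr_eq0 -lt0n.
Qed.

Lemma QZ_annihilated (S : int -> Prop) :
  S 0 -> (forall x y, S x -> S y -> S (x - y)) -> ~ S 1 ->
  exists2 d : QZ, d <> 0 & forall k, S k -> d *~ k = 0.
Proof.
move=> S0 SB S1; have [m mP] := int_subgroup S0 SB.
have m1 : m != 1 by apply/eqP => m1; apply: S1; apply/mP; rewrite m1.
pose n := if m == 0 then 2%N else m.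
have n1 : (1 < n)%N by rewrite /n; clear -m1; case: m m1 => [|[|]].
have n0 : n%:R != 0 :> rat by rewrite pnatr_eq0; case: n n1.
exists (\pi_QZ n%:R^-1) => [/QZ_eq0|k /mP/dvdzP[q ->]].
  move=> /intrP[z zP].
  have : z%:~R * n%:R = 1 :> rat by rewrite -zP mulVf.
  rewrite -[n%:R]/(n%:Z%:~R) -intrM => /eqP; rewrite -[1]/(1%:~R) eqr_int => /eqP zn.
  have : (n%:Z %| 1)%Z by apply/dvdzP; exists z.
  by rewrite dvdz1 /= => /eqP n1'; rewrite n1' in n1.
rewrite -raddfMz; apply/QZ_eq0; rewrite -mulrzr intrM mulrCA rpredM ?intr_int //.
rewrite /n; case: (eqVneq m 0%N) => [->|m0]; first by rewrite mulr0 rpred0.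
by rewrite mulVf ?rpred1 // pnatr_eq0.
Qed.

Definition dprod (I : Type) (M : I -> zmodType) := forall i, M i.

Section DProd.
Variables (I : Type) (M : I -> zmodType).
Implicit Types f g h : dprod M.

Let add f g : dprod M := fun i => f i + g i.
Let opp f : dprod M := fun i => - f i.
Let zero : dprod M := fun=> 0.

Let addA : associative add.
Proof. by move=> f g h; apply: functional_extensionality_dep => i; exact: addrA. Qed.
Let addC : commutative add.
Proof. by move=> f g; apply: functional_extensionality_dep => i; exact: addrC. Qed.
Let add0 : left_id zero add.
Proof. by move=> f; apply: functional_extensionality_dep => i; exact: add0r. Qed.
Let addN : left_inverse zero opp add.
Proof. by move=> f; apply: functional_extensionality_dep => i; exact: addNr. Qed.

HB.instance Definition _ := gen_eqMixin (dprod M).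
HB.instance Definition _ := gen_choiceMixin (dprod M).
HB.instance Definition _ := GRing.isZmodule.Build (dprod M) addA addC add0 addN.

Lemma dprodB f g i : (f - g) i = f i - g i. Proof. by []. Qed.

End DProd.

Section PresheafLemmas.
Variables (X : topologicalType) (P : presheaf X).

Lemma restr_irr (U V : openset X) (VU VU' : V `<=` U) (s : P U) :
  restr VU s = restr VU' s.
Proof. by rewrite (Prop_irrelevance VU VU'). Qed.

End PresheafLemmas.

(* A homomorphism from the stalk of P at x to Q/Z, presented as a compatible
   family of homomorphisms on the sections over the neighborhoods of x. *)
Record germ_functional (X : topologicalType) (P : presheaf X) (x : X) :=
  GermFunctional {
    germ_app :> forall U : openset X, carrier U x -> {additive P U -> QZ};
    germ_restr : forall (U V : openset X) (VU : V `<=` U)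
      (Ux : carrier U x) (Vx : carrier V x) (s : P U),
      germ_app Vx (restr VU s) = germ_app Ux s }.

Lemma extend_germ (X : topologicalType) (P : presheaf X) (x : X)
    (R : forall U : openset X, P U -> QZ -> Prop) :
  (forall U : openset X, carrier U x -> R U 0 0) ->
  (forall (U : openset X) s t d e, R U s d -> R U t e -> R U (s - t) (d - e)) ->
  (forall (U V : openset X) (VU : V `<=` U) s d, carrier V x ->
    R U s d -> R V (restr VU s) d) ->
  (forall (U : openset X) d, carrier U x -> R U 0 d -> d = 0) ->
  exists phi : germ_functional P x,
    forall (U : openset X) (Ux : carrier U x) s d, R U s d -> phi U Ux s = d.
Proof.
move=> R0 RB Rres Rfun.
pose ext (U : openset X) (s : P U) : dprod P := fun V =>
  if pselect (V `<=` U) is left VU then restr VU s else 0.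
have extE (U V : openset X) (VU : V `<=` U) (s : P U) : ext U s V = restr VU s.
  by rewrite /ext; case: pselect => // VU'; exact: restr_irr.
pose G : set (dprod P * QZ) := [set p | exists (U : openset X) (s : P U),
  [/\ carrier U x, R U s p.2 &
    forall (V : openset X) (VU : V `<=` U), carrier V x -> p.1 V = restr VU s]].
have [||f fP] := @extend_hom (dprod P) QZ _ G; first exact: QZ_divisible.
  split.
  - exists (opensetT X), 0; split=> //; first exact: R0.
    by move=> V VU _; rewrite raddf0.
  - move=> [b d] [c e] [U [s [/= Ux Rs bs]]] [V [t [/= Vx Rt ct]]].
    pose W := opensetI U V.
    have WU : W `<=` U := @subIsetl _ U V.
    have WV : W `<=` V := @subIsetr _ U V.
    exists W, (restr WU s - restr WV t); split=> //=.
      by apply: RB; apply: Rres.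
    move=> W' W'W W'x; rewrite dprodB (bs _ (subset_trans W'W WU)) //.
    rewrite (ct _ (subset_trans W'W WV)) // raddfB /=.
    by rewrite !(restr_comp _ _ (subset_trans W'W _)).
  - move=> d [U [s [/= Ux Rs bs]]]; apply: (Rfun U) => //.
    by move: Rs; rewrite -[s](restr_id (@subset_refl _ _)) -bs.
have f0 (b : dprod P) (U : openset X) : carrier U x ->
    (forall V : openset X, V `<=` U -> carrier V x -> b V = 0) -> f b = 0.
  move=> Ux b0; apply: fP; exists U, 0; split=> //; first exact: R0.
  by move=> V VU Vx; rewrite raddf0 /= b0.
have phi_add (U : openset X) : carrier U x -> zmod_morphism (fun s : P U => f (ext U s)).
  move=> Ux s t; apply/eqP; rewrite -subr_eq0 -!raddfB; apply/eqP.
  apply: (f0 _ U) => // V VU Vx; rewrite !dprodB !extE raddfB.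
  by rewrite subrr.
pose phi (U : openset X) (Ux : carrier U x) : {additive P U -> QZ} :=
  HB.pack (fun s : P U => f (ext U s))
    (GRing.isZmodMorphism.Build (P U) QZ _ (phi_add U Ux)).
have phi_restr (U V : openset X) (VU : V `<=` U)
      (Ux : carrier U x) (Vx : carrier V x) (s : P U) :
    phi V Vx (restr VU s) = phi U Ux s.
  apply/eqP; rewrite -subr_eq0 /= -raddfB; apply/eqP.
  apply: (f0 _ V) => // W WV Wx.
  rewrite dprodB (extE _ _ WV) (extE _ _ (subset_trans WV VU)).
  by rewrite (restr_comp _ _ (subset_trans WV VU)) subrr.
exists (GermFunctional phi_restr) => U Ux s d Rs /=.
by apply: fP; exists U, s; split=> //= V VU _; rewrite extE.
Qed.

Section ProductSheaf.
Variables (X : topologicalType) (K : Type) (pt : K -> X).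

Let sec (U : openset X) : zmodType := {k : K | carrier U (pt k)} -> QZ.

Definition prod_ev (U : openset X) (f : sec U) (k : {k : K | carrier U (pt k)}) : QZ := f k.

Let res_fun (U V : openset X) (VU : V `<=` U) (f : sec U) : sec V :=
  fun k => f (exist _ (sval k) (VU _ (proj2_sig k))).

Let res_add (U V : openset X) (VU : V `<=` U) : zmod_morphism (res_fun VU).
Proof. by []. Qed.

Let res (U V : openset X) (VU : V `<=` U) : {additive sec U -> sec V} :=
  HB.pack (res_fun VU) (GRing.isZmodMorphism.Build _ _ _ (res_add VU)).

Let sig_irr (U : openset X) (k k' : {k : K | carrier U (pt k)}) :
  sval k = sval k' -> k = k'.
Proof. by case: k k' => [k ?] [k' ?] /= kk'; exact: eq_exist. Qed.

Let res_id (U : openset X) (UU : U `<=` U) (s : sec U) : res UU s = s.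
Proof. by apply/funext => k /=; congr s; exact: sig_irr. Qed.

Let res_comp (U V W : openset X) (VU : V `<=` U) (WV : W `<=` V)
  (WU : W `<=` U) (s : sec U) : res WV (res VU s) = res WU s.
Proof. by apply/funext => k /=; congr s; exact: sig_irr. Qed.

Definition prod_presheaf : presheaf X := Presheaf res_id res_comp.

Lemma prod_is_sheaf : is_sheaf prod_presheaf.
Proof.
move=> I U W UW WU s s_compat.
have cov (k : {k : K | carrier W (pt k)}) : exists i, carrier (U i) (pt (sval k)).
  by have [i _ Ui] := WU _ (svalP k); exists i.
pose idx k := sval (cid (cov k)).
have idxP k : carrier (U (idx k)) (pt (sval k)) := svalP (cid (cov k)).
have sE i j k (ik : carrier (U i) (pt k)) (jk : carrier (U j) (pt k)) :
    prod_ev (s i) (exist _ k ik) = prod_ev (s j) (exist _ k jk).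
  have := congr1 (fun f : sec (opensetI (U i) (U j)) => prod_ev f (exist _ k (conj ik jk))) (s_compat i j).
  rewrite /= /prod_ev /res_fun /= => H.
  by etransitivity; [etransitivity; [|exact: H]|]; congr (s _ _); exact: sig_irr.
exists (fun k => prod_ev (s (idx k)) (exist _ (sval k) (idxP k))); split.
  move=> i; apply/funext => -[k ik]; rewrite /= /res_fun /=; exact: (sE _ _ _ _ ik).
move=> t tP; apply/funext => k.
rewrite -(tP (idx k)) /= /res_fun /=; congr (t _); exact: sig_irr.
Qed.

Definition prod_sheaf : sheaf X := Sheaf prod_is_sheaf.

Section ProdHom.
Variables (B : sheaf X) (phi : forall k, germ_functional B (pt k)).

Let app_fun (U : openset X) (s : B U) : prod_sheaf U :=
  fun k => phi (sval k) U (proj2_sig k) s.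

Let app_add (U : openset X) : zmod_morphism (@app_fun U).
Proof. by move=> s t; apply/funext => k; rewrite /app_fun raddfB. Qed.

Let app (U : openset X) : {additive B U -> prod_sheaf U} :=
  HB.pack (@app_fun U) (GRing.isZmodMorphism.Build _ _ _ (@app_add U)).

Let app_nat (U V : openset X) (VU : V `<=` U) (s : B U) :
  app V (restr VU s) = restr VU (app U s).
Proof.
by apply/funext => k; rewrite /= /app_fun /= /res_fun /app_fun /=; exact: germ_restr.
Qed.

Definition prod_hom : sheaf_hom B prod_sheaf := SheafHom app_nat.

Lemma prod_homE (U : openset X) (s : B U) k :
  prod_ev (prod_hom U s) k = phi (sval k) U (proj2_sig k) s.
Proof. by []. Qed.

End ProdHom.

Lemma prod_sheaf_injective : injective_sheaf prod_sheaf.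
Proof.
move=> A B i f imono.
have phi_ex : forall k, exists phi : germ_functional B (pt k),
    forall (U : openset X) (Uk : carrier U (pt k)) (a : A U),
      phi U Uk (i U a) = prod_ev (f U a) (exist _ k Uk).
  move=> k; have [||||phi phiP] := @extend_germ X B (pt k) (fun U b d =>
      exists (W : openset X) (WU : W `<=` U) (Wk : carrier W (pt k)) (a : A W),
        i W a = restr WU b /\ prod_ev (f W a) (exist _ k Wk) = d).
  - move=> U Uk; exists U, (@subset_refl _ _), Uk, 0.
    by rewrite !raddf0.
  - move=> U s t d e [W [WU [Wk [a [ia fa]]]]] [W' [W'U [W'k [a' [ia' fa']]]]].
    pose W'' := opensetI W W'.
    have sW : W'' `<=` W := @subIsetl _ W W'.
    have sW' : W'' `<=` W' := @subIsetr _ W W'.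
    have W''k : carrier W'' (pt k) by [].
    exists W'', (subset_trans sW WU), W''k, (restr sW a - restr sW' a'); split.
      rewrite !raddfB /= !hom_nat ia ia' !(restr_comp _ _ (subset_trans sW WU)).
      by [].
    rewrite raddfB /= !hom_nat -fa -fa'; congr (_ - _).
      by rewrite /= /res_fun /=; congr (f _ _ _); exact: sig_irr.
    by rewrite /= /res_fun /=; congr (f _ _ _); exact: sig_irr.
  - move=> U V VU s d Vk [W [WU [Wk [a [ia fa]]]]].
    pose W' := opensetI W V.
    have sW : W' `<=` W := @subIsetl _ W V.
    have sV : W' `<=` V := @subIsetr _ W V.
    have W'k : carrier W' (pt k) by [].
    exists W', sV, W'k, (restr sW a); split.
      by rewrite hom_nat ia !(restr_comp _ _ (subset_trans sW WU)).
    by rewrite hom_nat -fa /= /res_fun /=; congr (f _ _ _); exact: sig_irr.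
  - move=> U d Uk [W [WU [Wk [a [ia <-]]]]].
    have -> : a = 0 by apply: (imono W); rewrite ia !raddf0.
    by rewrite raddf0.
  exists phi => U Uk a; apply: phiP.
  by exists U, (@subset_refl _ _), Uk, a; split=> //; rewrite restr_id.
pose phi k := sval (cid (phi_ex k)).
have phiP k := svalP (cid (phi_ex k)).
exists (prod_hom phi) => U s; apply/funext => -[k Uk].
transitivity (prod_ev (prod_hom phi U (i U s)) (exist _ k Uk)) => //.
by rewrite prod_homE; exact: phiP.
Qed.

End ProductSheaf.

(* J is the product of copies of Q/Z indexed by the functionals on germs of B
   which vanish on the image of f, so the cokernel sheaf is never formed. *)
Lemma injective_step (X : topologicalType) (A B : sheaf X) (f : sheaf_hom A B) :
  exists (J : sheaf X) (g : sheaf_hom B J), injective_sheaf J /\ sheaf_exact f g.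
Proof.
pose K := {x : X & {phi : germ_functional B x |
  forall (U : openset X) (Ux : carrier U x) (a : A U), phi U Ux (f U a) = 0}}.
pose pt (k : K) := projT1 k.
pose phi (k : K) : germ_functional B (pt k) := sval (projT2 k).
exists (prod_sheaf pt), (prod_hom phi); split; first exact: prod_sheaf_injective.
move=> U t; split=> [gt0 x Ux|loc]; last first.
  apply/funext => -[[x [psi psif]] Ux].
  transitivity (prod_ev (prod_hom phi U t) (exist _ (existT _ x (exist _ psi psif)) Ux)) => //.
  rewrite prod_homE /=.
  have [V [VU [Vx [s fs]]]] := loc x Ux.
  by rewrite -(germ_restr _ VU Ux Vx) -fs psif.
apply: contrapT => notloc.
pose S (k : int) := exists (W : openset X) (WU : W `<=` U),
  carrier W x /\ exists a : A W, f W a = restr WU t *~ k.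
have S0 : S 0.
  exists U, (@subset_refl _ _); split=> //; exists 0.
  by rewrite raddf0 mulr0z.
have SB k l : S k -> S l -> S (k - l).
  move=> [W [WU [Wx [a fa]]]] [W' [W'U [W'x [a' fa']]]].
  pose W'' := opensetI W W'.
  have sW : W'' `<=` W := @subIsetl _ W W'.
  have sW' : W'' `<=` W' := @subIsetr _ W W'.
  exists W'', (subset_trans sW WU); split=> //.
  exists (restr sW a - restr sW' a').
  rewrite raddfB /= !hom_nat fa fa' !raddfMz /= !(restr_comp _ _ (subset_trans sW WU)).
  by rewrite mulrzBr ?mulNrz.
have S1 : ~ S 1.
  move=> [W [WU [Wx [a fa]]]]; apply: notloc.
  by exists W, WU; split=> //; exists a; rewrite fa mulr1z.
have [d0 d0n0 d0S] := QZ_annihilated S0 SB S1.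
have [||||psi psiP] := @extend_germ X B x (fun V s d => exists k : int, d = d0 *~ k /\
  exists (W : openset X) (WV : W `<=` V) (WU : W `<=` U),
    carrier W x /\ exists a : A W, restr WV s = restr WU t *~ k + f W a).
- move=> V Vx; exists 0; split; first by rewrite mulr0z.
  exists (opensetI U V), (@subIsetr _ U V), (@subIsetl _ U V); split=> //.
  by exists 0; rewrite !raddf0 ?mulr0z addr0.
- move=> V s s' d d' [k [-> [W [WV [WU [Wx [a sa]]]]]]].
  move=> [k' [-> [W' [W'V [W'U [W'x [a' sa']]]]]]].
  exists (k - k'); split; first by rewrite mulrzBr.
  pose W'' := opensetI W W'.
  have sW : W'' `<=` W := @subIsetl _ W W'.
  have sW' : W'' `<=` W' := @subIsetr _ W W'.
  exists W'', (subset_trans sW WV), (subset_trans sW WU); split=> //.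
  exists (restr sW a - restr sW' a').
  have e := congr1 (restr sW) sa; have e' := congr1 (restr sW') sa'.
  move: e e'; rewrite !raddfD /= !raddfMz /= -!hom_nat.
  rewrite !(restr_comp _ _ (subset_trans sW WV)) !(restr_comp _ _ (subset_trans sW WU)).
  move=> e e'; rewrite !raddfN /= ?mulrNz e e'.
  by rewrite opprD addrACA.
- move=> V V' V'V s d V'x [k [-> [W [WV [WU [Wx [a sa]]]]]]].
  exists k; split=> //.
  pose W' := opensetI W V'.
  have sW : W' `<=` W := @subIsetl _ W V'.
  have sV : W' `<=` V' := @subIsetr _ W V'.
  exists W', sV, (subset_trans sW WU); split=> //; exists (restr sW a).
  have := congr1 (restr sW) sa; rewrite raddfD /= raddfMz /= -hom_nat.
  by rewrite !(restr_comp _ _ (subset_trans sW WV)) !(restr_comp _ _ (subset_trans sW WU)).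
- move=> V d Vx [k [-> [W [WV [WU [Wx [a sa]]]]]]]; apply: d0S.
  exists W, WU; split=> //; exists (- a).
  by move/esym/eqP: sa; rewrite raddf0 addr_eq0 raddfN => /eqP.
have psif (V : openset X) (Vx : carrier V x) (a : A V) : psi V Vx (f V a) = 0.
  apply: psiP; exists 0; split; first by rewrite mulr0z.
  exists (opensetI U V), (@subIsetr _ U V), (@subIsetl _ U V); split=> //.
  by exists (restr (@subIsetr _ U V : opensetI U V `<=` V) a); rewrite mulr0z add0r hom_nat.
pose k : K := existT _ x (exist _ psi psif).
have := congr1 (fun h => prod_ev h (exist _ k Ux)) gt0.
rewrite prod_homE => psit; apply: d0n0; rewrite -[d0]mulr1z.
have <- : psi U Ux t = 0 := psit.
apply/esym/psiP; exists 1; split=> //.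
exists U, (@subset_refl _ _), (@subset_refl _ _); split=> //.
by exists 0; rewrite raddf0 addr0 mulr1z.
Qed.

Section ZeroHom.
Variables (X : topologicalType) (F G : sheaf X).

Definition zero_hom : sheaf_hom F G.
Proof.
by exists (fun U => (\0 : {additive F U -> G U})) => U V VU s /=; rewrite raddf0.
Defined.

End ZeroHom.

Lemma injective_resolution_exists (X : topologicalType) (F : sheaf X) :
  inhabited (injective_resolution F).
Proof.
pose stage := {AB : sheaf X * sheaf X & sheaf_hom AB.1 AB.2}.
have /cid[next nextP] : exists next : forall s : stage, {J : sheaf X & sheaf_hom (projT1 s).2 J},
    forall s, injective_sheaf (projT1 (next s)) /\ sheaf_exact (projT2 s) (projT2 (next s)).
  suff /(fun H s => cid (H s)) H : forall s : stage, exists s' : {J : sheaf X & sheaf_hom (projT1 s).2 J},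
    injective_sheaf (projT1 s') /\ sheaf_exact (projT2 s) (projT2 s').
    by exists (fun s => sval (H s)) => s; exact: (svalP (H s)).
  move=> s; have [J [g gP]] := injective_step (projT2 s).
  by exists (existT _ J g).
pose succ (s : stage) : stage :=
  existT (fun AB : sheaf X * sheaf X => sheaf_hom AB.1 AB.2)
    ((projT1 s).2, projT1 (next s)) (projT2 (next s)).
pose start : stage :=
  existT (fun AB : sheaf X * sheaf X => sheaf_hom AB.1 AB.2) (F, F) (zero_hom F F).
pose st := fix st n := if n is m.+1 then succ (st m) else succ start.
pose obj n := (projT1 (st n)).2.
pose diff n : sheaf_hom (obj n) (obj n.+1) := projT2 (st n.+1).
pose aug : sheaf_hom F (obj 0%N) := projT2 (st 0%N).
apply: inhabits; refine (@InjectiveResolution X F obj aug diff _ _ _ _).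
- by case=> [|n]; exact: (nextP _).1.
- move=> U s t st_eq; apply/eqP; rewrite -subr_eq0; apply/eqP.
  have /(nextP start).2 loc : aug U (s - t) = 0 by rewrite raddfB st_eq subrr.
  pose I := {x : X & {V : openset X | V `<=` U /\ (carrier V x /\
     forall VU : V `<=` U, restr VU (s - t) = 0)}}.
  have VU (i : I) : sval (projT2 i) `<=` U := (svalP (projT2 i)).1.
  have cov : U `<=` \bigcup_i sval (projT2 (i : I)).
    move=> x Ux; have [V [VU' [Vx [r /= rP]]]] := loc x Ux.
    have H : V `<=` U /\ (carrier V x /\ forall VU : V `<=` U, restr VU (s - t) = 0).
      split=> //; split=> // VU''; rewrite (restr_irr _ VU'); exact: esym rP.
    by exists (existT _ x (exist _ V H)).
  have [|z [_ zP]] := @sheafP X F I (fun i => sval (projT2 i)) U VU cov (fun=> 0).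
    by move=> i j; rewrite !raddf0.
  rewrite -(zP (s - t)); first by rewrite -(zP 0) // => i; rewrite raddf0.
  by move=> i; exact: (svalP (projT2 i)).2.2.
- exact: (nextP _).2.
- by move=> p; exact: (nextP _).2.
Qed.

(* homology f g is ker g / (im f :&: ker g) for A --f--> B --g--> C; when
   g \o f = 0, as below, this is ker g / im f. *)
Section Homology.
Variables (A B C : zmodType) (f : {additive A -> B}) (g : {additive B -> C}).

Definition kernel_pred : {pred B} := [pred b | g b == 0].

Fact kernel_zmod_closed : zmod_closed kernel_pred.
Proof.
split=> [|x y]; rewrite !inE ?raddf0 // => /eqP gx /eqP gy.
by rewrite raddfB gx gy subrr.
Qed.

HB.instance Definition _ := GRing.isZmodClosed.Build B kernel_pred kernel_zmod_closed.

Definition homology_cycle := {b : B | b \in kernel_pred}.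

HB.instance Definition _ := SubChoice.on homology_cycle.
HB.instance Definition _ := [SubChoice_isSubZmodule of homology_cycle by <:].

Definition homology_boundary : {pred homology_cycle} :=
  [pred z | `[< exists a : A, f a = val z >]].

Fact boundary_zmod_closed : zmod_closed homology_boundary.
Proof.
have boundaryP z : reflect (exists a : A, f a = val z) (z \in homology_boundary).
  exact: asboolP.
split=> [|x y /boundaryP[a fa] /boundaryP[b fb]]; apply/boundaryP.
  by exists 0; rewrite !raddf0.
by exists (a - b); rewrite !raddfB fa fb.
Qed.

HB.instance Definition _ :=
  GRing.isZmodClosed.Build homology_cycle homology_boundary boundary_zmod_closed.

Definition homology : zmodType := Quotient.quot homology_boundary.

Lemma homology_eq0 :
  (forall h : homology, h = 0) <-> (forall b, g b = 0 -> exists a, f a = b).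
Proof.
split=> [H b gb|H h].
  have bker : b \in kernel_pred by rewrite inE gb.
  pose z : homology_cycle := exist _ b bker.
  have : \pi_homology z == \pi_homology 0 by apply/eqP; rewrite [LHS]H [RHS]H.
  by rewrite -Quotient.idealrBE subr0 => /asboolP.
rewrite -[h]reprK; have -> : (0 : homology) = \pi_homology 0 by rewrite raddf0.
apply/eqP; rewrite -Quotient.idealrBE subr0; apply/asboolP.
by apply: H; apply/eqP; exact: (valP (repr h)).
Qed.

End Homology.

Definition some_injective_resolution (X : topologicalType) (F : sheaf X) :
  injective_resolution F := inhabited_witness (injective_resolution_exists F).

(* H^p(X, F): the p-th right derived functor of global sections, i.e. the
   p-th cohomology of 0 -> I^0(X) -> I^1(X) -> ... *)
Definition sheaf_cohomology (X : topologicalType) (F : sheaf X) (p : nat) : zmodType :=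
  let I := some_injective_resolution F in
  let d q := @hom_app X _ _ (res_diff I q) (opensetT X) in
  match p with
  | 0 => homology (\0 : {additive res_obj I 0 (opensetT X) -> res_obj I 0 (opensetT X)})
                  (d 0)
  | q.+1 => homology (d q) (d q.+1)
  end.

Definition topdim_le (X : topologicalType) (n : nat) : Prop :=
  forall p : nat, (n < p)%N -> forall (F : sheaf X) (h : sheaf_cohomology F p), h = 0.

(* The least n is taken among natural numbers; the notion is meant for
   nonempty X. *)
Definition topological_dimension (X : topologicalType) (d : nat) : Prop :=
  topdim_le X d /\ forall m : nat, topdim_le X m -> (d <= m)%N.

Definition homeomorphic_subsets (S T : topologicalType) (U : set S) (V : set T) : Prop :=
  exists (f : S -> T) (g : T -> S),
    [/\ forall x, U x -> V (f x), forall y, V y -> U (g y),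
        forall x, U x -> g (f x) = x & forall y, V y -> f (g y) = y] /\
    {within U, continuous f} /\ {within V, continuous g}.

Definition topological_manifold (R : realType) (n : nat) (X : topologicalType) : Prop :=
  forall x : X, exists U : set X, [/\ open U, U x &
    exists V : set 'rV[R]_n, open V /\ homeomorphic_subsets U V].

Definition paracompact (X : topologicalType) : Prop :=
  forall C : set (set X), (forall U, C U -> open U) -> \bigcup_(U in C) U = setT ->
  exists D : set (set X),
    [/\ forall V, D V -> open V, \bigcup_(V in D) V = setT,
        forall V, D V -> exists2 U, C U & V `<=` U &
        forall x : X, exists2 W, nbhs x W &
          finite_set [set V | D V /\ V `&` W !=set0]].

(* Main.v *)
(** Flabbiness of injective sheaves lets every section of the resolution be taken
    global, its germs being recorded by the open set [zeros s] where they vanish.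
    The statement to prove is then that cocycles of degree p > n near a closed set
    B which vanish near a closed subset A of B are coboundaries of sections which
    vanish near A.

    If B is compact and f : B -> R is continuous, this holds for (B, A) in degree
    p.+1 as soon as it holds for the fibers of f in degrees p and p.+1: primitives
    found near two adjacent slabs differ, near the fiber which separates them, by
    a cocycle of degree one less, and a correction makes them agree there.  By
    induction on the number of coordinates this settles the compact subsets of a
    chart.  The passage to the whole manifold is a Zorn argument along a locally
    finite cover by such compact sets; the relative form, with A the part already
    treated, is what allows a primitive to be extended without being changed. *)

Require Import Defs.
From mathcomp Require Import all_boot all_order all_algebra.
From mathcomp Require Import boolp classical_sets functions cardinality.
From mathcomp Require Import reals topology normedtype.
Import Order.TTheory GRing.Theory Num.Theory numFieldNormedType.Exports.
Local Open Scope classical_set_scope.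
Local Open Scope ring_scope.

Set Implicit Arguments.
Unset Strict Implicit.
Unset Printing Implicit Defensive.

(** * Flabby sheaves and the zero sets of global sections *)

Definition restrT (X : topologicalType) (F : presheaf X) (U : openset X)
    (s : F (opensetT X)) : F U :=
  restr (U := opensetT X) (V := U) (@subsetT X U) s.

Definition flabby (X : topologicalType) (F : presheaf X) : Prop :=
  forall (U : openset X) (s : F U), exists t, restrT U t = s.

Lemma restr_mulrz (X : topologicalType) (F : presheaf X) (U V : openset X)
    (VU : V `<=` U) (s : F U) (k : int) :
  restr VU (s *~ k) = restr VU s *~ k.
Proof. exact: raddfMz. Qed.

Section Zeros.
Variables (X : topologicalType) (F : sheaf X).
Implicit Types (s t : F (opensetT X)) (U : openset X).

(** Both [s] and 0 glue the zero family on the cover by such [V], so the uniqueness half of the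
    sheaf axiom applies. *)
Lemma locally_zero U (s : F U) :
  (forall x, carrier U x ->
     exists (V : openset X) (VU : V `<=` U), carrier V x /\ restr VU s = 0) ->
  s = 0.
Proof.
move=> s0.
pose I := {x : X & {V : openset X | V `<=` U /\ (carrier V x /\
   forall VU : V `<=` U, restr VU s = 0)}}.
have VU (i : I) : sval (projT2 i) `<=` U := (svalP (projT2 i)).1.
have cov : U `<=` \bigcup_i sval (projT2 (i : I)).
  move=> x Ux; have [V [VU' [Vx rV]]] := s0 x Ux.
  have H : V `<=` U /\ (carrier V x /\ forall VU : V `<=` U, restr VU s = 0).
    by split=> //; split=> // VU''; rewrite (restr_irr _ VU').
  by exists (existT _ x (exist _ V H)).
have [|z [_ zP]] := @sheafP X F I (fun i => sval (projT2 i)) U VU cov (fun=> 0).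
  by move=> i j; rewrite !raddf0.
rewrite -(zP s); first by rewrite -(zP 0) // => i; rewrite raddf0.
by move=> i; exact: (svalP (projT2 i)).2.2.
Qed.

(** The complement of the support. A set included in [zeros (s - t)] is one along which [s] and [t]
    have the same germs. *)
Definition zeros s : set X := [set x | exists U : openset X, carrier U x /\ restrT U s = 0].

Lemma restr_restrT U (V : openset X) (VU : V `<=` U) s : restr VU (restrT U s) = restrT V s.
Proof. exact: restr_comp. Qed.

Lemma zeros_open s : open (zeros s).
Proof.
rewrite openE => x [U [Ux sU]]; rewrite /interior /=.
apply: (filterS (P := U)); first by move=> y Uy; exists U.
exact: open_nbhs_nbhs (conj (carrier_open U) Ux).
Qed.

Lemma restrT0P U s : restrT U s = 0 <-> U `<=` zeros s.
Proof.
split=> [sU x Ux|sU]; first by exists U.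
apply: locally_zero => x Ux; have [V [Vx sV]] := sU x Ux.
exists (opensetI U V), (@subIsetl _ U V); split=> //.
by rewrite restr_restrT -(restr_restrT (@subIsetr _ U V : opensetI U V `<=` V)) sV raddf0.
Qed.

Lemma zerosT s : zeros s = setT -> s = 0.
Proof.
by move=> sT; rewrite -[s](restr_id (@subsetT _ (opensetT X))); apply/restrT0P; rewrite sT.
Qed.

Lemma zeros0 : zeros 0 = setT.
Proof.
by apply/seteqP; split=> // x _; exists (opensetT X); split=> //; rewrite /restrT raddf0.
Qed.

Lemma zerosB s t : zeros s `&` zeros t `<=` zeros (s - t).
Proof.
move=> x [[U [Ux sU]] [V [Vx tV]]]; exists (opensetI U V); split=> //.
rewrite /restrT raddfB /= -/(restrT _ s) -/(restrT _ t).
rewrite -(restr_restrT (@subIsetl _ U V : opensetI U V `<=` U)) sU.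
by rewrite -(restr_restrT (@subIsetr _ U V : opensetI U V `<=` V)) tV !raddf0 addr0.
Qed.

Lemma zerosN s : zeros (- s) = zeros s.
Proof.
have sub t : zeros t `<=` zeros (- t).
  by move=> x tx; rewrite -sub0r; apply: zerosB; split=> //; rewrite zeros0.
by apply/seteqP; split; [rewrite -{2}[s]opprK|]; exact: sub.
Qed.

Lemma zerosBC s t : zeros (s - t) = zeros (t - s).
Proof. by rewrite -zerosN opprB. Qed.

Lemma zerosD s t : zeros s `&` zeros t `<=` zeros (s + t).
Proof. by rewrite -[t in s + t]opprK -[in zeros t]zerosN; exact: zerosB. Qed.

Lemma zerosB_trans t s u x : zeros (s - t) x -> zeros (t - u) x -> zeros (s - u) x.
Proof. by move=> st tu; rewrite -(subrKA t s (- u)); apply: zerosD. Qed.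

Hypothesis Fflabby : flabby F.

(** The sheaf axiom glues the [s i] over the union of the [U i], and flabbiness extends the result
    to all of [X]. *)
Lemma glue_family (I : Type) (U : I -> set X) (s : I -> F (opensetT X)) :
  (forall i, open (U i)) ->
  (forall i j, U i `&` U j `<=` zeros (s i - s j)) ->
  exists u, forall i, U i `<=` zeros (u - s i).
Proof.
move=> oU sP; pose O i := Openset (oU i).
pose W := Openset (bigcup_open (D := setT) (fun i _ => oU i)).
have OW i : O i `<=` W by move=> x Ux; exists i.
have [|t [tP _]] := @sheafP X F I O W OW (@subset_refl _ _) (fun i => restrT (O i) (s i)).
  move=> i j; apply/eqP; rewrite !restr_restrT -subr_eq0 -raddfB; apply/eqP.
  by apply/restrT0P; exact: sP.
have [u uP] := Fflabby t; exists u => i.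
apply/(@restrT0P (O i)); rewrite /restrT raddfB /= -/(restrT _ u) -/(restrT _ (s i)).
by rewrite -(restr_restrT (@OW i)) uP tP subrr.
Qed.

Lemma glue_open (U V : set X) s t : open U -> open V ->
  U `&` V `<=` zeros (s - t) ->
  exists u, U `<=` zeros (u - s) /\ V `<=` zeros (u - t).
Proof.
move=> oU oV st.
have [||u uP] := @glue_family bool (fun b => if b then U else V)
  (fun b => if b then s else t).
- by case.
- case=> -[] //=; [by rewrite subrr zeros0| |by rewrite subrr zeros0].
  by rewrite setIC zerosBC.
by exists u; split; [exact: (uP true)|exact: (uP false)].
Qed.

End Zeros.

Lemma zeros_hom (X : topologicalType) (F G : sheaf X) (f : sheaf_hom F G)
  (s : F (opensetT X)) : zeros s `<=` zeros (f _ s).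
Proof.
by move=> x [U [Ux sU]]; exists U; split=> //; rewrite /restrT -hom_nat [restr _ _]sU raddf0.
Qed.

(** * Flabbiness of injective sheaves *)

Lemma prod_sheaf_flabby (X : topologicalType) (K : Type) (pt : K -> X) :
  flabby (prod_sheaf pt).
Proof.
move=> U s.
(* Extension by 0 outside [U]: sections of [prod_sheaf] are arbitrary families. *)
exists (fun k => if pselect (carrier U (pt (sval k))) is left Uk
                 then prod_ev s (exist _ (sval k) Uk) else 0).
apply/funext => -[k Uk]; rewrite /restrT /=; case: pselect => // Uk'.
by rewrite (Prop_irrelevance Uk' Uk).
Qed.

(** If the germ of [s] at [x] is nonzero, the integers that kill it form a proper subgroup. The
    cyclic group it generates then has a homomorphism to Q/Z which is nonzero on it, and
    divisibility extends this to the stalk. *)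
Lemma germ_functional_separates (X : topologicalType) (F : sheaf X)
    (U : openset X) (s : F U) :
  (forall x (Ux : carrier U x) (phi : germ_functional F x), phi U Ux s = 0) -> s = 0.
Proof.
move=> s0; apply: locally_zero => x Ux; apply: contrapT => notloc.
pose S (k : int) := exists (W : openset X) (WU : W `<=` U),
  carrier W x /\ restr WU s *~ k = 0.
have [||/=|d0 d0n0 d0S] := @QZ_annihilated S.
- by exists U, (@subset_refl _ _); rewrite mulr0z.
- move=> k l [W [WU [Wx sk]]] [W' [W'U [W'x sl]]].
  pose W'' := opensetI W W'.
  have sW : W'' `<=` W := @subIsetl _ W W'.
  have sW' : W'' `<=` W' := @subIsetr _ W W'.
  exists W'', (subset_trans sW WU); split=> //.
  rewrite mulrzBr -{1}(restr_comp WU sW) -(restr_comp W'U sW').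
  by rewrite -(restr_mulrz sW) -(restr_mulrz sW') sk sl !raddf0 addr0.
- by move=> [W [WU [Wx]]]; rewrite mulr1z => sW; apply: notloc; exists W, WU.
(* The relation sends [k] times the germ of [s] to [d0 *~ k]; it is single-valued because every
   integer in [S] kills [d0]. *)
have [||||psi psiP] := @extend_germ X F x (fun V t d => exists k : int, d = d0 *~ k /\
  exists (W : openset X) (WV : W `<=` V) (WU : W `<=` U),
    carrier W x /\ restr WV t = restr WU s *~ k).
- move=> V Vx; exists 0; split; first by rewrite mulr0z.
  exists (opensetI U V), (@subIsetr _ U V), (@subIsetl _ U V); split=> //.
  by rewrite raddf0 mulr0z.
- move=> V t t' d d' [k [-> [W [WV [WU [Wx tW]]]]]] [k' [-> [W' [W'V [W'U [W'x tW']]]]]].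
  exists (k - k'); split; first by rewrite mulrzBr.
  pose W'' := opensetI W W'.
  have sW : W'' `<=` W := @subIsetl _ W W'.
  have sW' : W'' `<=` W' := @subIsetr _ W W'.
  exists W'', (subset_trans sW WV), (subset_trans sW WU); split=> //.
  rewrite raddfB /= -(restr_comp WV sW) -(restr_comp W'V sW') tW tW' !restr_mulrz.
  by rewrite (restr_comp _ _ (subset_trans sW WU)) (restr_comp _ _ (subset_trans sW WU)) mulrzBr.
- move=> V V' V'V t d V'x [k [-> [W [WV [WU [Wx tW]]]]]]; exists k; split=> //.
  pose W' := opensetI W V'.
  have sW : W' `<=` W := @subIsetl _ W V'.
  have sV : W' `<=` V' := @subIsetr _ W V'.
  exists W', sV, (subset_trans sW WU); split=> //.
  rewrite (restr_comp _ _ (subset_trans sW WV)) -(restr_comp WV sW) tW restr_mulrz.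
  by rewrite (restr_comp _ _ (subset_trans sW WU)).
- move=> V d Vx [k [-> [W [WV [WU [Wx]]]]]]; rewrite raddf0 => sk; apply: d0S.
  by exists W, WU.
apply: d0n0; rewrite -[d0]mulr1z -(s0 x Ux psi); apply/esym/psiP.
exists 1; split=> //; exists U, (@subset_refl _ _), (@subset_refl _ _).
by rewrite mulr1z.
Qed.

(* J is a retract of the flabby sheaf of all its germ functionals. *)
Lemma injective_flabby (X : topologicalType) (J : sheaf X) :
  injective_sheaf J -> flabby J.
Proof.
move=> Jinj.
pose K := {x : X & germ_functional J x}.
pose i := prod_hom (pt := fun k : K => projT1 k) (fun k => projT2 k).
have id_nat (U V : openset X) (VU : V `<=` U) (s : J U) :
  (idfun : {additive J V -> J V}) (restr VU s) =
  restr VU ((idfun : {additive J U -> J U}) s) by [].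
have imono : sheaf_mono i.
  move=> U s t st; apply/eqP; rewrite -subr_eq0; apply/eqP.
  apply: germ_functional_separates => x Ux phi.
  have : i U (s - t) = 0 by rewrite raddfB st subrr.
  move/(congr1 (fun h => prod_ev h (exist _ (existT _ x phi : K) Ux))).
  by rewrite prod_homE.
have [g gi] := Jinj _ _ i (SheafHom id_nat) imono.
move=> U s; have [t tU] := prod_sheaf_flabby (i U s).
by exists (g _ t); rewrite /restrT -hom_nat [restr _ _]tU gi.
Qed.

(** * Separation and gluing along closed sets *)

Lemma compact_closed_separation (X : topologicalType) (K C : set X) :
  regular_space X -> compact K -> closed C -> K `&` C = set0 ->
  exists U V : set X, [/\ open U, open V, K `<=` U, C `<=` V & U `&` V = set0].
Proof.
move=> Xreg /compact_near_coveringP Kcpt Ccl KC.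
(* An empty [C] is set apart because its neighbourhood filter is not proper. *)
have [->|/set0P C0] := eqVneq C set0.
  exists setT, set0; split=> //; [exact: openT|exact: open0|exact: setI0].
have Cproper := set_nbhs_pfilter C0.
have anti (A B : set X) : A `<=` B ->
    K `<=` (fun x => ~ closure B x) -> K `<=` (fun x => ~ closure A x).
  by move=> AB KB x /KB Bx /(closure_subset AB).
(* Regularity treats one point of [K] at a time. Compactness, in near-covering form along the
   shrinking neighbourhoods of [C], yields one neighbourhood whose closure misses all of [K]. *)
have : \forall W \near powerset_filter_from (set_nbhs C), K `<=` (fun x => ~ closure W x).
  apply: Kcpt => x Kx.
  have [|U [V [oU oV Ux CV UV]]] := (regular_openP x).1 (Xreg x) C Ccl.
    by move=> Cx; have : (K `&` C) x by []; rewrite KC.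
  exists (U, [set W | W `<=` V]) => /=; last first.
    move=> [y W] /= [Uy WV] /(_ U (open_nbhs_nbhs (conj oU Uy)))[z [/WV Vz Uz]].
    by have : (U `&` V) z by []; rewrite UV.
  split; first exact: open_nbhs_nbhs.
  have VC : set_nbhs C V by apply/set_nbhsP; exists V; split.
  exact: small_set_sub VC.
move=> /(near_powerset_filter_fromP _ anti)[W /set_nbhsP[V [oV CV VW]] KW].
exists (~` closure V), V; split=> //; first by rewrite openC; exact: closed_closure.
  by move=> x /KW; apply: contra_not; exact: closure_subset.
by apply/seteqP; split=> // x [nVx Vx]; apply: nVx; exact: subset_closure.
Qed.

(** Outside the open set [W] where [s] and [t] agree, [A] and [B] are disjoint and can be separated.
    Adding [W] to both separating sets gives open neighbourhoods of [A] and [B] that meet only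
    inside [W]. *)
Lemma glue_compact (X : topologicalType) (F : sheaf X) (A B : set X)
    (s t : F (opensetT X)) : flabby F -> regular_space X ->
  closed A -> compact B -> A `&` B `<=` zeros (s - t) ->
  exists u, A `<=` zeros (u - s) /\ B `<=` zeros (u - t).
Proof.
move=> Fflabby Xreg Acl Bcpt st; pose W := zeros (s - t).
have oW : open W := zeros_open _.
have cW : closed (~` W) by rewrite closedC.
have [|||V [U [oV oU BV AU UV]]] :=
    @compact_closed_separation X (B `&` ~` W) (A `&` ~` W) Xreg.
- exact: compact_closedI.
- exact: closedI.
- by apply/seteqP; split=> // x [[Bx nWx] [Ax _]]; apply: nWx; exact: st.
have [|||u [uA uB]] := @glue_open X F Fflabby (U `|` W) (V `|` W) s t;
  [exact: openU|exact: openU| |].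
  move=> x [[Ux|//] [Vx|//]]; have : (V `&` U) x by [].
  by rewrite UV.
exists u; split=> x xAB; [apply: uA|apply: uB];
  by have [Wx|nWx] := pselect (W x); [right|left; (apply: AU + apply: BV)].
Qed.

Lemma closed_bigcup_locally_finite (X : topologicalType) (I : choiceType)
    (D : set I) (N : X -> set X) (K : I -> set X) :
  (forall x, nbhs x (N x)) ->
  (forall x, finite_set [set i | D i /\ K i `&` N x !=set0]) ->
  (forall i, D i -> closed (K i)) -> closed (\bigcup_(i in D) K i).
Proof.
move=> Nx fin Kcl x clx; pose S := [set i | D i /\ K i `&` N x !=set0].
have : closed (\bigcup_(i in S) K i).
  by apply: closed_bigcup => [|i [Di _]]; [exact: (fin x)|exact: Kcl].
case/(_ x) => [B Bx|i [Di _] Kix]; last by exists i.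
have [y [[i Di Kiy] [By Ny]]] := clx (B `&` N x) (filterI Bx (Nx x)).
by exists y; split=> //; exists i => //; split=> //; exists y.
Qed.

(** Continuity is given only at points of [S], so a limit point is first placed in [S], which is
    closed because [X] is Hausdorff. *)
Lemma compact_setI_preimage (X Y : topologicalType) (f : X -> Y) (S : set X) (Q : set Y) :
  hausdorff_space X -> compact S -> {in S, continuous f} -> closed Q ->
  compact (S `&` f @^-1` Q).
Proof.
move=> Xhaus Scpt fcont Qcl; apply: (subclosed_compact _ Scpt); last exact: subIsetl.
have Scl := compact_closed Xhaus Scpt.
move=> x clx; have Sx : S x.
  by apply: Scl => N Nx; have [y [[Sy _] Ny]] := clx _ Nx; exists y.
split=> //; apply: Qcl => N Nfx.
have fx : {for x, continuous f} by apply: fcont; rewrite inE.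
by have [y [[_ Qy] Ny]] := clx _ (fx _ Nfx); exists (f y).
Qed.

(** * Relative acyclicity and its dependence on coordinates *)

Section Acyclic.
Variables (X : topologicalType) (I : nat -> sheaf X).
Variable d : forall p, sheaf_hom (I p) (I p.+1).
Hypothesis Iflabby : forall p, flabby (I p).
Hypothesis Iexact : forall p, sheaf_exact (d p) (d p.+1).

Local Notation G p := (I p (opensetT X)).
Local Notation del p := (@hom_app X _ _ (d p) (opensetT X)).

Lemma del_del p (y : G p) : del p.+1 (del p y) = 0.
Proof.
apply/Iexact => x _; exists (opensetT X), (@subset_refl _ _); split=> //.
by exists y; rewrite restr_id.
Qed.

Lemma zeros_del p (y : G p) : zeros y `<=` zeros (del p y).
Proof. exact: zeros_hom. Qed.

(** Exactness gives a primitive on a neighbourhood of [x], and flabbiness makes it global. *)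
Lemma local_primitive p (z : G p.+1) x :
  zeros (del p.+1 z) x -> exists y : G p, zeros (z - del p y) x.
Proof.
move=> [U [Ux]]; rewrite /restrT -hom_nat => /Iexact/(_ x Ux)[V [VU [Vx [s sP]]]].
have [y ys] := Iflabby s; exists y, V; split=> //.
rewrite /restrT raddfB /= -hom_nat [restr _ y]ys sP.
by rewrite (restr_comp (U := opensetT X) _ VU (@subsetT _ V)) addrN.
Qed.

(* Vanishing of the relative cohomology group H^(p+1)(B, A) of the germs of
   sections along closed sets; by flabbiness germs are taken to be global. *)
Definition acyclic p (B A : set X) : Prop :=
  forall z : G p.+1, B `<=` zeros (del p.+1 z) -> A `<=` zeros z ->
  exists y : G p, B `<=` zeros (z - del p y) /\ A `<=` zeros y.

(** Base of the induction on coordinates. If [A] is nonempty, [z] already vanishes near [B] and 0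
    works; otherwise the condition along [A] is void and [local_primitive] at the only point of [B]
    suffices. *)
Lemma acyclic_subsingleton p (B A : set X) : A `<=` B ->
  (forall x y, B x -> B y -> x = y) -> acyclic p B A.
Proof.
move=> AB B1 z dz0 z0.
have [[a Aa]|A0] := pselect (A !=set0).
  exists 0; rewrite zeros0 raddf0 subr0; split=> // x Bx.
  by rewrite (B1 _ _ Bx (AB _ Aa)); exact: z0.
have AE y : A `<=` zeros (y : G p) by move=> x Ax; case: A0; exists x.
have [[b Bb]|B0] := pselect (B !=set0); last first.
  by exists 0; split=> // x Bx; case: B0; exists x.
have [y yb] := local_primitive (dz0 _ Bb); exists y; split=> // x Bx.
by rewrite (B1 _ _ Bx Bb).
Qed.

Hypothesis Xreg : regular_space X.

(** A sweep along the values of [f]: the levels below which a good primitive exists have a supremum,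
    and the primitive is pushed past it unless all of [B] is reached. Degree [p.+1] on fibers
    provides primitives near each level, degree [p] the corrections that join them. *)
Lemma acyclic_fibers (R : realType) (f : X -> R) p (B A : set X) :
  hausdorff_space X -> compact B -> compact A -> A `<=` B ->
  {in B, continuous f} ->
  (forall t, acyclic p (B `&` f @^-1` [set t]) (A `&` f @^-1` [set t])) ->
  (forall t, acyclic p.+1 (B `&` f @^-1` [set t]) (A `&` f @^-1` [set t])) ->
  acyclic p.+1 B A.
Proof.
move=> Xhaus Bcpt Acpt AB fcont fib fibS z dz0 z0.
have within (S : set X) : S `<=` B -> {within S, continuous f}.
  move=> SB; apply: continuous_in_subspaceT => x /set_mem Sx.
  by apply: fcont; rewrite inE; exact: SB.
have cptI (S : set X) (Q : set R) : compact S -> S `<=` B -> closed Q ->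
    compact (S `&` f @^-1` Q).
  move=> Scpt SB; apply: compact_setI_preimage => // x /set_mem Sx.
  by apply: fcont; rewrite inE; exact: SB.
pose good (S : set R) (y : G p.+1) :=
  B `&` f @^-1` S `<=` zeros (z - del p.+1 y) /\ A `&` f @^-1` S `<=` zeros y.
have local t : exists2 e : R, 0 < e & exists y, good `[t - e, t + e]%classic y.
  have [||y [By Ay]] := fibS t z.
  - by move=> x [Bx _]; exact: dz0.
  - by move=> x [Ax _]; exact: z0.
  (* The points where [y] fails. The image of [K] under [f] is compact and misses [t], hence misses
     an interval around [t]. *)
  pose K := (B `&` ~` zeros (z - del p.+1 y)) `|` (A `&` ~` zeros y).
  have KB : K `<=` B by move=> x [[]//|[/AB]].
  have : compact K.
    by apply: compactU; apply: compact_closedI => //; rewrite closedC; exact: zeros_open.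
  move=> /(continuous_compact (within _ KB)) /(compact_closed (@norm_hausdorff _ _)).
  rewrite -openC openE => /(_ t); case.
    move=> [x Kx fx]; case: Kx => -[Sx]; apply; [exact: By|exact: Ay].
  move=> e /= e0 /subsetP te; exists (e / 2); first by rewrite divr_gt0.
  have te' x : `[t - e / 2, t + e / 2]%classic (f x) -> ~ K x.
    rewrite /= in_itv /= => /andP[h1 h2] Kx.
    have := te (f x); rewrite !inE; apply; last by exists x.
    rewrite /ball /=; apply: (@le_lt_trans _ _ (e / 2)); last first.
      by rewrite ltr_pdivrMr // mulr_natr mulr2n ltrDl.
    by rewrite distrC ler_distl h1 h2.
  by exists y; split=> x [Sx /te' nK]; apply: contrapT => nz; apply: nK; [left|right].
have extend (t e r r' : R) y' y : good `[t - e, t + e]%classic y' ->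
    t - e <= r -> r <= r' -> r' <= t + e -> good [set x | x <= r] y ->
    exists y, good [set x | x <= r'] y.
  move=> [By' Ay'] tr rr' rt [By Ay].
  have fr x : f x = r -> `[t - e, t + e]%classic (f x).
    by move=> ->; rewrite /= in_itv /= tr (le_trans rr').
  have fr' x : f x = r -> f x <= r by move=> ->.
  (* Near the fiber of [r], [y] and [y'] are both primitives of [z], so their difference is a
     cocycle, with primitive [w]. *)
  have [||w [Bw Aw]] := fib r (y - y').
  - move=> x [Bx /= fx]; rewrite raddfB /=.
    apply: (zerosB_trans (t := z)); first by rewrite zerosBC; apply: By; split=> //; exact: fr'.
    by apply: By'; split=> //; exact: fr.
  - move=> x [Ax /= fx]; apply: zerosB; split; [apply: Ay|apply: Ay']; split=> //.
      exact: fr'.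
    exact: fr.
  (* [w'] has the germs of [w] along the fiber but vanishes near all of [A], so correcting by it
     keeps the condition along [A]. *)
  have [|||w' [Aw' Bw']] := @glue_compact _ _ A (B `&` f @^-1` [set r]) 0 w (@Iflabby _) Xreg.
  - exact: compact_closed.
  - exact: cptI.
  - by move=> x [Ax [Bx fx]]; rewrite sub0r zerosN; apply: Aw.
  (* Adding a coboundary does not change the differential of [y'], and it makes [y1] agree with [y]
     near the fiber of [r]. *)
  pose y1 := y' + del p w'.
  have y1r x : B x -> f x = r -> zeros (y - y1) x.
    move=> Bx fx; rewrite /y1 opprD addrA; apply: (zerosB_trans (t := del p w)).
      exact: Bw.
    by rewrite -raddfB; apply: zeros_del; rewrite zerosBC; exact: Bw'.
  have [|||u [uB1 uB2]] := @glue_compact _ _ (B `&` f @^-1` [set x | x <= r])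
    (B `&` f @^-1` `[r, r']%classic) y y1 (@Iflabby _) Xreg.
  - by apply: compact_closed => //; apply: cptI => //; exact: closed_le.
  - by apply: cptI => //; exact: itv_closed.
  - move=> x [[Bx /= h1] [_ /=]]; rewrite in_itv /= => /andP[h2 _].
    by apply: y1r => //; apply/eqP; rewrite eq_le h1.
  exists u.
  have cases x : f x <= r' -> f x <= r \/ `[r, r']%classic (f x).
    move=> h; have [|h'] := leP (f x) r; first by left.
    by right; rewrite /= in_itv /= h ltW.
  have inte x : `[r, r']%classic (f x) -> `[t - e, t + e]%classic (f x).
    rewrite /= !in_itv /= => /andP[h1 h2].
    by rewrite (le_trans tr h1) (le_trans h2 rt).
  split=> x [Sx /cases[] h].
  - apply: (zerosB_trans (t := del p.+1 y)); first exact: By.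
    by rewrite -raddfB; apply: zeros_del; rewrite zerosBC; exact: uB1.
  - apply: (zerosB_trans (t := del p.+1 y')); first by apply: By'; split=> //; exact: inte.
    have -> : del p.+1 y' = del p.+1 y1 by rewrite /y1 raddfD /= del_del addr0.
    by rewrite -raddfB; apply: zeros_del; rewrite zerosBC; exact: uB2.
  - rewrite -[u](subrK y); apply: zerosD; split; first by apply: uB1; split=> //; exact: AB.
    exact: Ay.
  - rewrite -[u](subrK y1); apply: zerosD; split; first by apply: uB2; split=> //; exact: AB.
    apply: zerosD; split; first by apply: Ay'; split=> //; exact: inte.
    by apply: zeros_del; rewrite -[w']subr0; exact: Aw'.
have [M [_ MP]] := compact_bounded (continuous_compact (within _ (@subset_refl _ B)) Bcpt).
have fM x : B x -> `|f x| <= M + 1.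
  by move=> Bx; apply: (MP (M + 1)); [rewrite ltrDl|exists x].
apply: contrapT => nex.
pose S := [set r | exists y, good [set x | x <= r] y].
have SM r : S r -> r <= M + 1.
  move=> [y yr]; rewrite leNgt; apply/negP => Mr; apply: nex.
  have fr x : B x -> f x <= r.
    by move=> Bx; rewrite (le_trans (ler_norm _)) // (le_trans (fM _ Bx)) // ltW.
  by exists y; split=> x Sx; apply yr; split=> //; apply: fr => //; exact: AB.
(* Below all values of [f] the conditions are void. *)
have S0 : S (- (M + 1) - 1).
  exists 0; have out x : B x -> ~ f x <= - (M + 1) - 1.
    move=> Bx; apply/negP; rewrite -ltNge.
    have := fM _ Bx; rewrite ler_norml => /andP[h _].
    by apply: lt_le_trans h; rewrite ltrBlDr ltrDl.
  by split=> x [Sx /= /out]; case => //; exact: AB.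
have Ssup : has_sup S by split; [exists (- (M + 1) - 1)|exists (M + 1)].
have [e e0 [y' y'P]] := local (sup S).
have [r Sr rlt] := sup_adherent e0 Ssup.
have rsup : r <= sup S by apply: sup_upper_bound.
have [y yP] := Sr.
(* A primitive up to some [r] within [e] below the supremum extends to [sup S + e], a
   contradiction. *)
have := extend _ _ _ (sup S + e) _ _ y'P (ltW rlt) _ (lexx _) yP.
case=> [|u uP]; first by rewrite (le_trans rsup) // lerDl ltW.
have : S (sup S + e) by exists u.
by move=> /(sup_upper_bound Ssup); rewrite leNgt ltrDl e0.
Qed.

(** Induction on [n], cutting by the last coordinate: on its fibers the remaining ones still
    separate points. Each cut uses one degree lower, whence the bound [n <= p]. *)
Lemma acyclic_coordinates (R : realType) n (f : nat -> X -> R) p (B A : set X) :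
  hausdorff_space X -> (n <= p)%N -> compact B -> compact A -> A `<=` B ->
  (forall i, (i < n)%N -> {in B, continuous (f i)}) ->
  (forall x y, B x -> B y -> (forall i, (i < n)%N -> f i x = f i y) -> x = y) ->
  acyclic p B A.
Proof.
move=> Xhaus; elim: n p B A => [|n IH] p B A np Bcpt Acpt AB fcont finj.
  by apply: acyclic_subsingleton => // x y Bx By; exact: finj.
case: p np => // p np.
have fib q t : (n <= q)%N ->
    acyclic q (B `&` f n @^-1` [set t]) (A `&` f n @^-1` [set t]).
  move=> nq; apply: IH => //.
  - by apply: compact_setI_preimage => //; exact: fcont.
  - apply: compact_setI_preimage => // x /set_mem Ax.
    by apply: fcont => //; rewrite inE; exact: AB.
  - by move=> x [/AB].
  - move=> i ni x /set_mem[Bx _]; apply: fcont; last by rewrite inE.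
    exact: ltnW.
  - move=> x y [Bx fx] [By fy] fxy; apply: finj => // i.
    by rewrite ltnS leq_eqVlt => /predU1P[->|/fxy//]; rewrite fx fy.
apply: (acyclic_fibers (f := f n)) => //; first exact: fcont.
  by move=> t; exact: fib.
by move=> t; apply: fib; exact: ltnW.
Qed.

(** * From a locally finite cover to the whole space *)

Lemma acyclic_local_global p (D : set (set X)) (N : X -> set X) (K : set X -> set X) :
  (forall U, D U -> open U) ->
  (forall x, open_nbhs x (N x)) ->
  (forall x, finite_set [set U | D U /\ U `&` N x !=set0]) ->
  (forall U, D U -> closed (K U)) -> (forall U, D U -> compact (K U)) ->
  (forall U, D U -> K U `<=` U) -> (forall x, exists2 U, D U & K U x) ->
  (forall U A, D U -> closed A -> A `<=` K U -> acyclic p (K U) A) ->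
  acyclic p setT set0.
Proof.
move=> Dopen Nx Dfin Kcl Kcpt KU Kcov Kac z dz0 _.
pose T := {a : set (set X) * G p |
  a.1 `<=` D /\ forall U, a.1 U -> K U `<=` zeros (z - del p a.2)}.
pose J (a : T) := (sval a).1; pose y (a : T) := (sval a).2.
have JD a : J a `<=` D := (svalP a).1.
have yP a U : J a U -> K U `<=` zeros (z - del p (y a)) := (svalP a).2 U.
(* An extension does not change y off the members it adds; by local finiteness,
   a chain is then stationary near each point. *)
pose le (a b : T) := J a `<=` J b /\
  forall x, (forall U, J b U -> ~ J a U -> ~ U x) -> zeros (y b - y a) x.
have [||||a amax] := @Zorn T (fun a b => `[< le a b >]).
- move=> a; apply/asboolP; split=> // x _; by rewrite subrr zeros0.
- move=> a b c /asboolP[ab yab] /asboolP[bc ybc]; apply/asboolP.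
  split; first exact: subset_trans bc.
  move=> x xac; apply: (zerosB_trans (t := y b)).
    by apply: ybc => U cU bU; apply: xac => // /ab.
  by apply: yab => U bU aU; apply: xac => //; exact: bc.
- move=> a b /asboolP[ab yab] /asboolP[ba _].
  have Jab : J a = J b by apply/seteqP.
  have /eqP : y b - y a = 0.
    by apply: zerosT; apply/seteqP; split=> // x _; apply: yab => U; rewrite Jab.
  rewrite subr_eq0 => /eqP yba.
  have sig_eq (c e : T) : sval c = sval e -> c = e.
    by case: c e => [c cP] [e eP]; exact: eq_exist.
  by apply: sig_eq; rewrite [LHS]surjective_pairing [RHS]surjective_pairing; congr pair.
- move=> C Ctot.
  have [[c0 Cc0]|C0] := pselect (C !=set0); last first.
    have P0 : (set0 : set (set X)) `<=` D /\
        forall U : set X, set0 U -> K U `<=` zeros (z - del p (0 : G p)).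
      by split=> U [].
    by exists (exist _ (set0, 0) P0) => a Ca; case: C0; exists a.
  pose Jmax : set (set X) := \bigcup_(a in C) J a.
  have dominated (s : seq (set X)) : (forall U, U \in s -> Jmax U) ->
      exists2 a, C a & forall U, U \in s -> J a U.
    elim: s => [|U s IHs] sJ; first by exists c0.
    have [|a Ca aP] := IHs; first by move=> V Vs; apply: sJ; rewrite inE Vs orbT.
    have [|b Cb bU] := sJ U; first by rewrite mem_head.
    have [/asboolP[ab _]|/asboolP[ba _]] := Ctot a b Ca Cb.
      by exists b => // V; rewrite inE => /predU1P[->|/aP/ab].
    by exists a => // V; rewrite inE => /predU1P[->|/aP//]; exact: ba.
  (* Only finitely many members of [Jmax] meet [N x], so one element [l x] of the chain contains
     them all. Later sections agree with [y (l x)] on [N x], and these stationary values glue. *)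
  have /choice[l lP] : forall x, exists a,
      C a /\ forall U, Jmax U -> U `&` N x !=set0 -> J a U.
    move=> x; have [s sE] := (finite_seqP _).1 (Dfin x).
    have [|a Ca aP] := dominated [seq U <- s | `[< Jmax U >]].
      by move=> U; rewrite mem_filter => /andP[/asboolP].
    exists a; split=> // U JU UN; apply: aP; rewrite mem_filter; apply/andP.
    split; first exact/asboolP.
    have : [set` s] U; last by [].
    rewrite -sE; split=> //.
    by have [b _ bU] := JU; exact: JD bU.
  have agree a x w : C a -> le (l x) a -> N x w -> zeros (y a - y (l x)) w.
    move=> Ca [_ h] Nw; apply: h => U aU; apply: contra_not => Uw.
    by apply: (lP x).2; [exists a|exists w].
  have [||u uP] := @glue_family _ _ (@Iflabby p) X N (fun x => y (l x)).
  - by move=> x; have [] := Nx x.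
  - move=> x x' w [Nw N'w].
    have [/asboolP h|/asboolP h] := Ctot _ _ (lP x).1 (lP x').1.
      by rewrite zerosBC; apply: agree => //; exact: (lP x').1.
    by apply: agree => //; exact: (lP x).1.
  have NN x : N x x by have [_] := Nx x.
  have tP : Jmax `<=` D /\ forall U, Jmax U -> K U `<=` zeros (z - del p u).
    split; first by move=> U [a _ /JD].
    move=> U JU x Kx; have lU : J (l x) U.
      apply: (lP x).2 => //; exists x; split=> //.
      by case: JU => a _ /JD DU; exact: KU Kx.
    apply: (zerosB_trans (t := del p (y (l x)))); first exact: yP Kx.
    by rewrite -raddfB; apply: zeros_del; rewrite zerosBC; exact: uP.
  exists (exist _ (Jmax, u) tP) => a Ca; apply/asboolP.
  split; first by move=> U aU; exists a.
  move=> x xP; apply: (zerosB_trans (t := y (l x))); first exact: uP.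
  have [/asboolP[_ h]|/asboolP h] := Ctot _ _ Ca (lP x).1.
    by apply: h => U lU; apply: xP; exists (l x) => //; exact: (lP x).1.
  by rewrite zerosBC; exact: agree.
have aD U : D U -> J a U.
  move=> DU; apply: contrapT => aU.
  pose KJ := \bigcup_(V in J a) K V.
  have KJcl : closed KJ.
    apply: (closed_bigcup_locally_finite (N := N)).
    - by move=> x; have := Nx x; rewrite open_nbhsE => -[].
    - move=> x; apply: sub_finite_set (Dfin x) => V [/JD DV [w [/(KU _ DV) Vw Nw]]].
      by split=> //; exists w.
    - by move=> V /JD; exact: Kcl.
  have KJz : KJ `<=` zeros (z - del p (y a)) by move=> x [V /yP]; exact.
  (* The defect of [y a] is a cocycle vanishing near [KJ]; its primitive near [K U] can be taken to
     vanish near the part of [K U] already treated. *)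
  have [||||w [Kw Jw]] := Kac U (K U `&` KJ) DU _ _ (z - del p (y a)).
  - by apply: closedI => //; exact: Kcl.
  - exact: subIsetl.
  - by move=> x _; rewrite raddfB /= del_del subr0; exact: dz0.
  - by move=> x [_ /KJz].
  (* Vanishing near [KJ] preserves the earlier primitive; vanishing off [U] makes the new pair an
     extension for [le]. *)
  have [|||w' [Cw' Kw']] := @glue_compact _ _ (KJ `|` ~` U) (K U) 0 w (@Iflabby p) Xreg.
  - by apply: closedU => //; rewrite closedC; exact: Dopen.
  - exact: Kcpt.
  - move=> x [[Jx|nUx] Kx]; rewrite sub0r zerosN; first exact: Jw.
    by case: nUx; exact: KU Kx.
  have bP : (J a `|` [set U]) `<=` D /\ forall V, (J a `|` [set U]) V ->
      K V `<=` zeros (z - del p (y a + w')).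
    split; first by move=> V [/JD|->].
    move=> V JV x Kx; rewrite raddfD /= opprD addrA.
    case: JV => [aV|VU].
      apply: zerosB; split; first exact: yP Kx.
      by apply: zeros_del; rewrite -[w']subr0; apply: Cw'; left; exists V.
    rewrite VU in Kx; apply: (zerosB_trans (t := del p w)); first exact: Kw.
    by rewrite -raddfB; apply: zeros_del; rewrite zerosBC; exact: Kw'.
  have ba : exist _ (_, _) bP = a :> T.
    apply: amax; apply/asboolP; split; first by move=> V; left.
    move=> x xP; rewrite /y /= addrC addKr -[w']subr0; apply: Cw'; right.
    by apply: xP => //; right.
  by apply: aU; rewrite -ba /J /=; right.
exists (y a); split=> // x _; have [U DU Kx] := Kcov x.
exact: yP (aD _ DU) _ Kx.
Qed.

End Acyclic.

(** * Shrinking of covers and compact coordinate patches *)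

Lemma paracompact_shrinking (X : topologicalType) (P : set X -> Prop) :
  paracompact X -> regular_space X ->
  (forall x, exists2 U, open_nbhs x U & P U) ->
  exists (D : set (set X)) (N : X -> set X) (K : set X -> set X),
    [/\ forall U, D U -> open U /\ exists2 V, P V & U `<=` V,
        forall x, open_nbhs x (N x),
        forall x, finite_set [set U | D U /\ U `&` N x !=set0],
        forall U, D U -> closed (K U) /\ K U `<=` U &
        forall x, exists2 U, D U & K U x].
Proof.
move=> Xpara Xreg Ploc.
have [||D [Dopen Dcov Dref Dfin]] := Xpara [set U | open U /\ P U].
- by move=> U [].
- by apply/seteqP; split=> // x _; have [U [oU Ux] PU] := Ploc x; exists U.
(* A second refinement, by sets with closure inside a member of [D], supplies the closed sets
   [K U]. *)
have [||D' [D'open D'cov D'ref D'fin]] :=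
    Xpara [set V | open V /\ exists2 U, D U & closure V `<=` U].
- by move=> V [].
- apply/seteqP; split=> // x _.
  have [U DU Ux] : (\bigcup_(U in D) U) x by rewrite Dcov.
  have [W Wx WU] := Xreg x U (open_nbhs_nbhs (conj (Dopen _ DU) Ux)).
  exists W°; last exact: nbhs_singleton (nbhs_interior Wx).
  split; first exact: open_interior.
  by exists U => //; apply: subset_trans WU; apply: closure_subset; exact: interior_subset.
have interior_nbhs (F : set (set X)) x :
    (exists2 W, nbhs x W & finite_set [set V | F V /\ V `&` W !=set0]) ->
    exists W, open_nbhs x W /\ finite_set [set V | F V /\ V `&` W !=set0].
  move=> [W Wx Wfin]; exists W°; split.
    by split; [exact: open_interior|exact: nbhs_singleton (nbhs_interior Wx)].
  apply: sub_finite_set Wfin => V [FV [w [Vw /interior_subset Ww]]].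
  by split=> //; exists w.
have /choice[N NP] := fun x => interior_nbhs D x (Dfin x).
have /choice[N' N'P] := fun x => interior_nbhs D' x (D'fin x).
(* These unions are closed by local finiteness of [D']. *)
exists D, N, (fun U => \bigcup_(V in [set V | D' V /\ closure V `<=` U]) closure V).
split.
- by move=> U DU; split; [exact: Dopen|have [V [_ PV] UV] := Dref _ DU; exists V].
- by move=> x; have [] := NP x.
- by move=> x; have [] := NP x.
- move=> U DU; split; last by move=> x [V [_ VU] /VU].
  apply: (closed_bigcup_locally_finite (N := N')).
  + by move=> x; have [/open_nbhs_nbhs] := N'P x.
  + move=> x; have [[oN' N'x] fin] := N'P x; apply: sub_finite_set fin.
    move=> V [[D'V _] [w [clw N'w]]]; split=> //.
    by apply: clw; exact: open_nbhs_nbhs.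
  + by move=> V _; exact: closed_closure.
- move=> x; have [V D'V Vx] : (\bigcup_(V in D') V) x by rewrite D'cov.
  have [V' [_ [U DU V'U]] VV'] := D'ref _ D'V.
  exists U => //; exists V; last exact: subset_closure.
  by split=> //; apply: subset_trans V'U; exact: closure_subset.
Qed.

Definition coordinate_patch (R : realType) (X : topologicalType) (n : nat)
    (K : set X) : Prop :=
  compact K /\ exists f : nat -> X -> R,
    (forall i, (i < n)%N -> {in K, continuous (f i)}) /\
    (forall x y, K x -> K y -> (forall i, (i < n)%N -> f i x = f i y) -> x = y).

Lemma compact_nbhs_rV (R : realType) n (v : 'rV[R]_n) (V : set 'rV[R]_n) :
  nbhs v V -> exists Q, [/\ nbhs v Q, compact Q & Q `<=` V].
Proof.
move=> /nbhs_ballP[e /= e0 eV]; have e20 : 0 < e / 2 by rewrite divr_gt0.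
exists (closed_ball v (e / 2)); split.
- exact: filterS (@subset_closed_ball _ _ _ _) (nbhsx_ballx _ _ e20).
- apply: bounded_closed_compact; last exact: closed_ball_closed.
  exists (e / 2 + `|v|); split=> [|M eM x]; first exact: num_real.
  rewrite closed_ballE // /closed_ball_ /= => vx; apply: le_trans (ltW eM).
  by rewrite -[x in `|x|](subrK v) (le_trans (ler_normD _ _)) // lerD2r distrC.
- exact: subset_trans (subset_closure_half e0) eV.
Qed.

(** A compact neighbourhood [Q] of the image of [x] in the chart is carried back by [g]. *)
Lemma manifold_coordinate_patch (R : realType) (X : topologicalType) (n : nat) (x : X) :
  topological_manifold R n X ->
  exists U K : set X, [/\ open_nbhs x U, U `<=` K & coordinate_patch R n K].
Proof.
move=> /(_ x)[U [oU Ux [V [oV [f [g [[fUV gVU gf fg] [fcont gcont]]]]]]]].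
rewrite continuous_open_subspace // in fcont.
have fx : nbhs (f x) V by apply: open_nbhs_nbhs; split=> //; exact: fUV.
have [Q [Qfx Qcpt QV]] := compact_nbhs_rV fx.
have KU : g @` Q `<=` U by move=> _ [v /QV Vv <-]; exact: gVU.
exists (U `&` f @^-1` Q)°, (g @` Q); split.
- split; first exact: open_interior.
  apply: filterI; first exact: open_nbhs_nbhs.
  by apply: fcont => //; rewrite inE.
- apply: subset_trans (@interior_subset _ _) _ => y [Uy Qfy].
  by exists (f y) => //; exact: gf.
- split.
    apply: continuous_compact => //.
    exact: continuous_subspaceW gcont.
  (* The entries of the chart map, padded by 0 from index [n] on. *)
  exists (fun i y => if insub i is Some j then f y ord0 j else 0); split.
    move=> i ni y /set_mem Ky; rewrite insubT.
    apply: (@continuous_comp _ _ _ f (fun M : 'rV[R]_n => M ord0 (Ordinal ni))).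
      by apply: fcont; rewrite inE; exact: KU.
    exact: coord_continuous.
  move=> y y' Ky Ky' fyy'; rewrite -(gf _ (KU _ Ky)) -(gf _ (KU _ Ky')).
  by congr g; apply/rowP => i; have := fyy' i (ltn_ord i); rewrite valK.
Qed.

Lemma manifold_regular (R : realType) (X : topologicalType) (n : nat) :
  hausdorff_space X -> topological_manifold R n X -> regular_space X.
Proof.
move=> Xhaus Xman x; have [U [K [Ux UK [Kcpt _]]]] := manifold_coordinate_patch x Xman.
exact: compact_regular (filterS UK (open_nbhs_nbhs Ux)).
Qed.

(** * Vanishing on manifolds *)

Lemma manifold_acyclic (R : realType) (X : topologicalType) (n : nat)
    (I : nat -> sheaf X) (d : forall p, sheaf_hom (I p) (I p.+1)) p :
  paracompact X -> hausdorff_space X -> topological_manifold R n X ->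
  (forall p, flabby (I p)) -> (forall p, sheaf_exact (d p) (d p.+1)) ->
  (n <= p)%N -> acyclic d p setT set0.
Proof.
move=> Xpara Xhaus Xman Iflabby Iexact np.
have Xreg := manifold_regular Xhaus Xman.
have [|D [N [K [DP Nopen Dfin KP Kcov]]]] := @paracompact_shrinking X
    (fun U => exists2 C, U `<=` C & coordinate_patch R n C) Xpara Xreg.
  move=> x; have [U [C [Ux UC Cpatch]]] := manifold_coordinate_patch x Xman.
  by exists U => //; exists C.
have patch U : D U -> exists2 C, K U `<=` C & coordinate_patch R n C.
  move=> DU; have [_ [V [C VC Cpatch] UV]] := DP U DU; exists C => //.
  by apply: subset_trans (KP U DU).2 _; exact: subset_trans VC.
have Kcpt U : D U -> compact (K U).
  move=> DU; have [C KC [Ccpt _]] := patch U DU.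
  exact: subclosed_compact (KP U DU).1 Ccpt KC.
apply: (acyclic_local_global Iflabby Iexact Xreg (D := D) (N := N) (K := K)) => //.
- by move=> U /DP[].
- by move=> U /KP[].
- by move=> U /KP[].
move=> U A DU Acl AK; have [C KC [Ccpt [f [fcont finj]]]] := patch U DU.
apply: (acyclic_coordinates Iflabby Iexact Xreg (n := n) (f := f)) => //.
- exact: Kcpt.
- by apply: subclosed_compact (Kcpt U DU) _.
- by move=> i ni x /set_mem Kx; apply: fcont => //; rewrite inE; exact: KC.
- by move=> x y /KC Cx /KC Cy; exact: finj.
Qed.

Theorem theorem3p5 (R : realType) (X : topologicalType) (n : nat)
    (Xparacompact : paracompact X) (Xhausdorff : hausdorff_space X)
    (Xmanifold : topological_manifold R n X) :
  (forall (F : sheaf X) (p : nat), (n < p)%N ->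
     forall h : sheaf_cohomology F p, h = 0) /\
  ([set: X] !=set0 ->
     exists d : nat, topological_dimension X d /\ (d <= n)%N).
Proof.
have vanish (F : sheaf X) (p : nat) : (n < p)%N -> forall h : sheaf_cohomology F p, h = 0.
  (* In degree [p.+1] the hypothesis reads [n <= p], the bound of [manifold_acyclic]. With [B] the
     whole space and [A] empty, acyclicity says that global cocycles are coboundaries. *)
  case: p => // p np; apply/homology_eq0 => z dz.
  pose I := some_injective_resolution F.
  have [||||||||y [zy _]] := @manifold_acyclic R X n (res_obj I) (res_diff I) p _ _ _ _ _ _ z.
  - exact: Xparacompact.
  - exact: Xhausdorff.
  - exact: Xmanifold.
  - by move=> q; apply: injective_flabby; exact: res_injective.
  - exact: res_exactS.
  - exact: np.
  - by rewrite dz zeros0.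
  - exact: sub0set.
  exists y; apply/esym/eqP; rewrite -subr_eq0; apply/eqP/zerosT.
  by apply/seteqP; split.
split=> // _.
have exP : exists m, `[< topdim_le X m >].
  by exists n; apply/asboolP => p np F h; exact: vanish.
case: (ex_minnP exP) => d /asboolP dP dmin; exists d; split.
  by split=> // m /asboolP; exact: dmin.
by apply: dmin; apply/asboolP => p np F h; exact: vanish.
Qed.
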